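(* Let $S=\{(d_0,q_0),(d_1,q_1)\}$ be a regular alphabet--base system with $d_1\ge 0\ge d_0$ and $q_0,q_1\in(1,2]$, and let $\mathcal U_S'$ be its set of unique expansions. (i) If $q_1\ge q_0$, then $\mathcal U_S'$ is infinite if and only if $q_0>1+\frac1{q_1}$. (ii) If $q_0\ge q_1$, then $\mathcal U_S'$ is infinite if and only if $q_1>1+\frac1{q_0}$.
   Context: A (two-element) alphabet--base system is an indexed pair $S=\{(d_0,q_0),(d_1,q_1)\}$ of pairs of real numbers with $q_0,q_1>1$. A sequence is an element $(j_i)=j_1j_2\cdots$ of $\{0,1\}^{\mathbb N}$, $\mathbb N=\{1,2,\ldots\}$. Put $\pi((j_i))=\sum_{i=1}^{\infty}\frac{d_{j_i}}{q_{j_1}\cdots q_{j_i}}$ (always convergent). A sequence $(j_i)$ is an expansion of $x\in\mathbb R$ if $\pi((j_i))=x$. With $j^\infty=jj\cdots$ we have $\pi(j^\infty)=\frac{d_j}{q_j-1}$; set $\lambda:=\min_j\pi(j^\infty)$, $\Lambda:=\max_j\pi(j^\infty)$. $S$ is regular if $\frac{d_0+\lambda}{q_0}<\frac{d_1+\lambda}{q_1}$, $\frac{d_0+\Lambda}{q_0}<\frac{d_1+\Lambda}{q_1}$ and $\frac{d_0+\Lambda}{q_0}\ge\frac{d_1+\lambda}{q_1}$. (When $d_1\ge0\ge d_0$ and $q_0,q_1\in(1,2]$, this only excludes $d_0=d_1=0$.) $\mathcal U_S$ is the set of $x\in[\lambda,\Lambda]$ having exactly one expansion, and $\mathcal U_S'$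 is the set of the corresponding expansions (sequences). *)

(* Defs.v *)
From mathcomp Require Import all_boot all_order all_algebra.
From mathcomp Require Import all_classical all_reals all_analysis.
From mathcomp Require Import ring lra.

Set Implicit Arguments.
Unset Strict Implicit.
Unset Printing Implicit Defensive.

Import Order.TTheory GRing.Theory Num.Theory.
Import numFieldNormedType.Exports.

Local Open Scope classical_set_scope.
Local Open Scope ring_scope.

(* The symbols 0 and 1 are encoded as false and true. *)
Record alphabet_base_system (R : realType) := AlphabetBaseSystem {
  digit : bool -> R;
  base : bool -> R;
  base_gt1 : forall j : bool, 1 < base j }.

(* Sequences are indexed from 0 instead of 1: this is the term of index
   i + 1 in the usual numbering. *)
Definition pi_term (R : realType) (S : alphabet_base_system R)
    (j : nat -> bool) (i : nat) : R :=
  digit S (j i) / \prod_(k < i.+1) base S (j k).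

Definition pi_val (R : realType) (S : alphabet_base_system R)
    (j : nat -> bool) : R :=
  limn (series (pi_term S j)).

Definition expansion (R : realType) (S : alphabet_base_system R)
    (x : R) (j : nat -> bool) : Prop :=
  pi_val S j = x.

Definition lambda_min (R : realType) (S : alphabet_base_system R) : R :=
  Num.min (pi_val S (fun=> false)) (pi_val S (fun=> true)).

Definition Lambda_max (R : realType) (S : alphabet_base_system R) : R :=
  Num.max (pi_val S (fun=> false)) (pi_val S (fun=> true)).

Definition regular (R : realType) (S : alphabet_base_system R) : Prop :=
  [/\ (digit S false + lambda_min S) / base S false
        < (digit S true + lambda_min S) / base S true,
      (digit S false + Lambda_max S) / base S false
        < (digit S true + Lambda_max S) / base S true
    & (digit S true + lambda_min S) / base S true
        <= (digit S false + Lambda_max S) / base S false].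

Definition univoque (R : realType) (S : alphabet_base_system R) : set R :=
  [set x | lambda_min S <= x <= Lambda_max S /\ exists! j, expansion S x j].

Definition unique_expansions (R : realType) (S : alphabet_base_system R) :
    set (nat -> bool) :=
  [set j | exists2 x, univoque S x & expansion S x j].

(* [limn] is total: this shows that [pi_val] never takes its default value. *)
Lemma is_cvg_pi_val (R : realType) (S : alphabet_base_system R)
    (j : nat -> bool) : cvgn (series (pi_term S j)).
Proof.
pose D := `|digit S false| + `|digit S true|.
pose q := Num.min (base S false) (base S true).
have q1 : 1 < q by rewrite lt_min !base_gt1.
have q0 : 0 < q by apply: lt_trans q1.
have qle b : q <= base S b by case: b; rewrite ge_min lexx ?orbT.
have D0 : 0 <= D by rewrite addr_ge0.
have Dle b : `|digit S b| <= D by case: b; rewrite /D ?lerDl ?lerDr.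
have prodle n : q ^+ n <= \prod_(k < n) base S (j k).
  rewrite -[X in q ^+ X]card_ord -prodr_const; apply: ler_prod => k _.
  by rewrite (ltW q0) qle.
apply: normed_cvg.
apply: (@series_le_cvg _ _ (geometric D q^-1)).
- by move=> n; rewrite /= normr_ge0.
- by move=> n; rewrite /geometric /= mulr_ge0 // exprn_ge0 // invr_ge0 ltW.
- move=> n; rewrite /geometric /= /pi_term normrM normfV.
  have P0 : 0 < \prod_(k < n.+1) base S (j k).
    by apply: lt_le_trans (prodle _); rewrite exprn_gt0.
  rewrite (gtr0_norm P0) ler_pM // ?invr_ge0 ?(ltW P0) // exprVn.
  rewrite lef_pV2 ?posrE ?exprn_gt0 //.
  apply: le_trans (prodle _); rewrite ler_eXn2l //.
- apply: is_cvg_geometric_series.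
  by rewrite ger0_norm ?invr_ge0 ?(ltW q0) // invf_lt1.
Qed.

Lemma pi_val_cst (R : realType) (S : alphabet_base_system R) (b : bool) :
  pi_val S (fun=> b) = digit S b / (base S b - 1).
Proof.
have q1 := base_gt1 S b.
have q0 : 0 < base S b by apply: lt_trans q1.
have -> : pi_val S (fun=> b) =
    limn (series (geometric (digit S b / base S b) (base S b)^-1)).
  rewrite /pi_val; congr (limn (series _)); apply/funext => n.
  rewrite /pi_term /geometric /= prodr_const card_ord exprS invfM exprVn.
  by rewrite mulrA.
have z1 : `|(base S b)^-1| < 1.
  by rewrite ger0_norm ?invr_ge0 ?(ltW q0) // invf_lt1.
rewrite (cvg_lim _ (@cvg_geometric_series R (digit S b / base S b) _ z1)) //.
by field; rewrite subr_eq0 gt_eqF //= gt_eqF.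
Qed.

(* Main.v *)
(** An affine change of variable sending the values of [b b b ...] and of
    [c c c ...] (where [{b, c} = {0, 1}]) to 0 and 1 turns prepending [b] into
    [u |-> u / q_b] and prepending [c] into [1 - u |-> (1 - u) / q_c], so the
    digits disappear from the problem.  A sequence is a unique expansion iff each
    tail starting with [b] has coordinate [u < 1 - 1 / q_c], for both choices of
    [b].

    The tail [b c b c ...] satisfies this iff [q_b > 1 + 1 / q_c].  If this holds
    for both choices of [b], then all the sequences [b^n c b c b ...] are unique
    expansions.  If [q_b <= 1 + 1 / q_c] and [q_c <= 2], then in a unique
    expansion [b c] is followed by [b] and [c b] is followed by [c]; a
    nonconstant unique expansion would thus end with [b c b c ...], which is
    impossible. *)
Require Import Defs.
From mathcomp Require Import all_boot all_order all_algebra.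
From mathcomp Require Import all_classical all_reals all_analysis.
From mathcomp Require Import ring lra.

Set Implicit Arguments.
Unset Strict Implicit.
Unset Printing Implicit Defensive.

Import Order.TTheory GRing.Theory Num.Theory.
Import numFieldNormedType.Exports.

Local Open Scope classical_set_scope.
Local Open Scope ring_scope.

(** * Tails of sequences and eventually alternating sequences *)

Definition tail (n : nat) (j : nat -> bool) : nat -> bool := fun i => j (i + n)%N.

Definition scons (b : bool) (j : nat -> bool) : nat -> bool :=
  fun i => if i is i'.+1 then j i' else b.

Lemma tail0 (j : nat -> bool) : tail 0 j = j.
Proof. by apply/funext => i; rewrite /tail addn0. Qed.

Lemma tailS (n : nat) (j : nat -> bool) : tail n.+1 j = tail 1 (tail n j).
Proof. by apply/funext => i; rewrite /tail addn1 addSnnS. Qed.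

Lemma tail_scons (b : bool) (j : nat -> bool) : tail 1 (scons b j) = j.
Proof. by apply/funext => i; rewrite /tail addn1. Qed.

(* [b^n c b c b c ...] with [c = ~~ b] *)
Definition alternating (b : bool) (n : nat) : nat -> bool :=
  fun i => if (i < n)%N then b else b (+) ~~ odd (i - n).

Lemma tail_alternatingS (b : bool) (n : nat) :
  tail 1 (alternating b n.+1) = alternating b n.
Proof. by apply/funext => i; rewrite /tail /alternating addn1 ltnS subSS. Qed.

Lemma tail_alternating0 (b : bool) : tail 1 (alternating b 0) = alternating b 1.
Proof.
apply/funext => -[|i]; rewrite /tail /alternating ?addn1 ?subn0 //= ?addbF //.
by rewrite subSS subn0 negbK.
Qed.

Lemma tail_alternating (b : bool) (n m : nat) :
  exists k, tail m (alternating b n) = alternating b k.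
Proof.
elim: m => [|m [k mk]]; first by exists n; rewrite tail0.
rewrite tailS mk; case: k {mk} => [|k].
  by exists 1%N; rewrite tail_alternating0.
by exists k; rewrite tail_alternatingS.
Qed.

Lemma alternating_inj (b : bool) : injective (alternating b).
Proof.
move=> m n mn; wlog lt_mn : m n mn / (m < n)%N.
  move=> H; have [lt_mn|lt_nm|//] := ltngtP m n; first exact: H.
  by apply/esym; apply: H.
have := congr1 (fun j => j m) mn.
by rewrite /alternating lt_mn ltnn subnn /= => /eqP; case: (b).
Qed.

(** * Two elementary facts about real numbers *)

(** As in Bernoulli's inequality, [|v n|] grows at least linearly with slope [|v 0| (q - 1)], which
    exceeds any bound unless [v 0] vanishes. *)
Lemma expanding_bounded_eq0 (R : realType) (q C : R) (v : nat -> R) :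
  1 < q -> (forall n, q * `|v n| <= `|v n.+1|) -> (forall n, `|v n| <= C) ->
  v 0%N = 0.
Proof.
move=> q1 expand bounded.
have growth n : `|v 0%N| * (1 + n%:R * (q - 1)) <= `|v n|.
  elim: n => [|n IH]; first by rewrite mul0r addr0 mulr1.
  apply: le_trans (expand n); rewrite -natr1.
  have v0 := normr_ge0 (v 0%N); have n0 : 0 <= n%:R :> R by [].
  have := ler_wpM2l (ltW (lt_trans ltr01 q1)) IH.
  have : 0 <= `|v 0%N| * (n%:R * (q - 1) ^+ 2).
    by rewrite mulr_ge0 // mulr_ge0 // exprn_even_ge0.
  rewrite expr2; nra.
apply: contrapT => /eqP; rewrite -normr_gt0 => v0.
have D0 : 0 < `|v 0%N| * (q - 1) by rewrite mulr_gt0 // subr_gt0.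
have C0 : 0 <= C by apply: le_trans (bounded 0%N).
have := archi_boundP (divr_ge0 C0 (ltW D0)).
set n := Num.Def.archi_bound _; rewrite ltr_pdivrMr // => Cn.
have := le_trans (growth n) (bounded n); nra.
Qed.

(** Compares [(p - 1) / D] with [(p - 1) / p]; the coordinates of the alternating sequences have the
    first form. *)
Lemma ltr_1subV (R : realFieldType) (p D x : R) :
  1 < p -> p < D -> D * x = p - 1 -> x < 1 - p^-1.
Proof.
move=> p1 pD Dx; have p0 : 0 < p by lra.
have D0 : 0 < D by lra.
have -> : x = (p - 1) / D by rewrite -Dx mulrAC divff ?mul1r // gt_eqF.
rewrite ltr_pdivrMr // -(@ltr_pM2l _ p) // mulrA (mulrBr p 1) mulr1 divff ?gt_eqF //.
by rewrite mulrC ltr_pM2l ?subr_gt0.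
Qed.

(** * Recursion and bounds for the values of sequences *)

Section Coordinate.
Context (R : realType) (S : alphabet_base_system R).
Implicit Types (b : bool) (j k : nat -> bool).

Lemma base_gt0 b : 0 < base S b.
Proof. exact: lt_trans (base_gt1 S b). Qed.

Lemma series_pi_termS j n :
  series (pi_term S j) n.+1 =
  (digit S (j 0%N) + series (pi_term S (tail 1 j)) n) / base S (j 0%N).
Proof.
rewrite !seriesEord /= big_ord_recl mulrDl mulr_suml; congr (_ + _).
  by rewrite /pi_term big_ord_recl big_ord0 mulr1.
apply: eq_bigr => i _; rewrite /pi_term /tail /= addn1 big_ord_recl invfM.
rewrite mulrA [RHS]mulrAC; congr (_ * _^-1).
by apply: eq_bigr => k _; rewrite addn1.
Qed.

Lemma pi_val_tail j :
  pi_val S j = (digit S (j 0%N) + pi_val S (tail 1 j)) / base S (j 0%N).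
Proof.
rewrite {1}/pi_val; apply/cvg_lim => //; rewrite -cvg_shiftS.
under eq_fun do rewrite series_pi_termS.
by apply: cvgMl; apply: cvgD; [exact: cvg_cst|exact: is_cvg_pi_val].
Qed.

(* 0 lies between the two extreme values, so every partial sum, being the image
   of 0 under a composition of contractions, stays between them. *)
Lemma pi_val_bounds j : digit S false <= 0 <= digit S true ->
  pi_val S (fun=> false) <= pi_val S j <= pi_val S (fun=> true).
Proof.
move=> /andP[d0 d1]; rewrite !pi_val_cst.
have q0 := base_gt1 S false; have q1 := base_gt1 S true.
set f0 := _ / _; set f1 := (X in _ <= _ <= X).
have f0E : f0 * (base S false - 1) = digit S false.
  by rewrite divfK // subr_eq0 gt_eqF.
have f1E : f1 * (base S true - 1) = digit S true.
  by rewrite divfK // subr_eq0 gt_eqF.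
have f0_le0 : f0 <= 0 by rewrite pmulr_lle0 // invr_gt0 subr_gt0.
have f1_ge0 : 0 <= f1 by rewrite divr_ge0 // subr_ge0 ltW.
have bounds n : forall k, f0 <= series (pi_term S k) n <= f1.
  elim: n => [|n IH] k; first by rewrite seriesEord /= big_ord0 f0_le0.
  rewrite series_pi_termS; have /andP[l0 l1] := IH (tail 1 k).
  rewrite ler_pdivlMr ?ler_pdivrMr ?base_gt0 //; apply/andP.
  by case: (k 0%N); split; nra.
by rewrite /pi_val; apply/andP; split; [apply: limr_ge|apply: limr_le];
  by [exact: is_cvg_pi_val|apply: nearW => n; have /andP[] := bounds n j].
Qed.

(** * The affine coordinate and its surjectivity *)

(** The parameter is the symbol whose constant sequence gets coordinate 0, so that each argument
    serves both symbols; [coordN] exchanges them. *)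
Definition coord b j : R :=
  (pi_val S j - pi_val S (fun=> b)) /
  (pi_val S (fun=> ~~ b) - pi_val S (fun=> b)).

Hypothesis digit_sign : digit S false <= 0 <= digit S true.
Hypothesis nondegenerate : pi_val S (fun=> false) < pi_val S (fun=> true).

Lemma coord_den_neq0 b : pi_val S (fun=> ~~ b) - pi_val S (fun=> b) != 0.
Proof.
by case: b; rewrite subr_eq0 ?(lt_eqF nondegenerate) ?(gt_eqF nondegenerate).
Qed.

Lemma coordN b j : coord (~~ b) j = 1 - coord b j.
Proof.
rewrite /coord negbK; have := coord_den_neq0 b; have := coord_den_neq0 (~~ b).
by rewrite negbK => ? ?; field; apply/andP.
Qed.

Lemma coord_eq b j k : coord b j = coord b k <-> pi_val S j = pi_val S k.
Proof.
split=> [|eq_jk]; last by rewrite /coord eq_jk.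
by move=> /(mulIf (invr_neq0 (coord_den_neq0 b))) /addIr.
Qed.

Lemma coord_ge0 b j : 0 <= coord b j.
Proof.
have /andP[l0 l1] := pi_val_bounds j digit_sign.
case: b; rewrite /coord.
  (* Here numerator and denominator are both nonpositive, so both signs are flipped. *)
  by rewrite -mulrNN -invrN !opprB divr_ge0 // subr_ge0 // ltW.
by rewrite divr_ge0 // subr_ge0 // ltW.
Qed.

Lemma coord_le1 b j : coord b j <= 1.
Proof. by have := coord_ge0 (~~ b) j; rewrite coordN subr_ge0. Qed.

Lemma coord_tail b j : j 0%N = b -> coord b (tail 1 j) = base S b * coord b j.
Proof.
move=> jb; rewrite /coord mulrA; congr (_ / _).
rewrite (pi_val_tail j) jb.
have E : pi_val S (fun=> b) * (base S b - 1) = digit S b.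
  by rewrite pi_val_cst divfK // subr_eq0 gt_eqF // base_gt1.
by rewrite mulrBr mulrCA divff ?gt_eqF ?base_gt0 // mulr1 -E; ring.
Qed.

Lemma coord_tailN b j : j 0%N = ~~ b ->
  1 - coord b (tail 1 j) = base S (~~ b) * (1 - coord b j).
Proof. by move=> jb; rewrite -!coordN coord_tail. Qed.

(** Greedy algorithm: [b] is chosen whenever [p * x] stays at most 1. The gap between the coordinate
    of the n-th tail and the n-th orbit point is multiplied by [p] or [r] at each step, yet stays
    bounded, so it is zero. *)
Lemma coord_surj b (y : R) : 1 <= (base S b)^-1 + (base S (~~ b))^-1 ->
  0 <= y <= 1 -> exists j, coord b j = y.
Proof.
move=> overlap y01; set p := base S b in overlap *.
set r := base S (~~ b) in overlap *.
have p0 : 0 < p := base_gt0 b; have r0 : 0 < r := base_gt0 (~~ b).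
have pV : p * p^-1 = 1 by rewrite divff // gt_eqF.
have rV : r * r^-1 = 1 by rewrite divff // gt_eqF.
pose next x := if x <= p^-1 then p * x else 1 - r * (1 - x).
pose x n := iter n next y.
(* Beyond 1/p, [overlap] gives 1 - x < 1 - 1/p <= 1/r, so the second branch also stays in the unit
   interval. *)
have x01 n : 0 <= x n <= 1.
  elim: n => [|n] //=; rewrite -/(x n) /next => /andP[x0 x1].
  case: ifPn => [le_x|]; last rewrite -ltNge => gt_x; apply/andP; split; nra.
pose j n := if x n <= p^-1 then b else ~~ b.
exists j; apply/eqP; rewrite -subr_eq0; apply/eqP.
pose v n := coord b (tail n j) - x n.
have -> : coord b j - y = v 0%N by rewrite /v tail0.
apply: (@expanding_bounded_eq0 _ (Num.min p r) 1).
- by rewrite lt_min !base_gt1.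
- move=> n; rewrite /v tailS /= -/(x n) /next.
  have jn : tail n j 0%N = if x n <= p^-1 then b else ~~ b by [].
  case: ifPn jn => _ jn.
    rewrite coord_tail // -/p -mulrBr normrM (gtr0_norm p0).
    by rewrite ler_wpM2r // ge_min lexx.
  have -> : coord b (tail 1 (tail n j)) - (1 - r * (1 - x n)) =
            r * (coord b (tail n j) - x n).
    by have := coord_tailN jn; rewrite -/r; lra.
  by rewrite normrM (gtr0_norm r0) ler_wpM2r // ge_min lexx orbT.
- move=> n; rewrite /v ler_norml.
  have /andP[x0 x1] := x01 n.
  by have := coord_ge0 b (tail n j); have := coord_le1 b (tail n j); lra.
Qed.

(** * Characterisation of unique expansions by the coordinates of their tails *)

Lemma unique_expansionsP j :
  unique_expansions S j <-> forall k, pi_val S k = pi_val S j -> k = j.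
Proof.
rewrite /unique_expansions /univoque /expansion /lambda_min /Lambda_max /=.
rewrite (min_idPl (ltW nondegenerate)) (max_idPr (ltW nondegenerate)).
split=> [[x [_ [i [_ iP]]] jx] k kj|jP].
  by rewrite -(iP j jx); apply/esym/iP; rewrite kj.
exists (pi_val S j) => //; split; first exact: pi_val_bounds.
by exists j; split=> // k /jP.
Qed.

(** Prepending the dropped symbols to another expansion of the tail would give another expansion of
    the whole. *)
Lemma unique_expansions_tail n j :
  unique_expansions S j -> unique_expansions S (tail n j).
Proof.
elim: n => [|n IH] in j *; first by rewrite tail0.
move=> /IH {IH}; rewrite tailS; set t := tail n j => /unique_expansionsP tP.
apply/unique_expansionsP => k eq_k.
rewrite -(tP (scons (t 0%N) k)) ?tail_scons //.
by rewrite pi_val_tail (pi_val_tail t) tail_scons /= eq_k.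
Qed.

(** Otherwise the coordinate lies in the image of prepending [~~ b], and surjectivity yields an
    expansion of the same value starting with [~~ b]. *)
Lemma unique_expansions_coord_lt b n j :
  1 <= (base S b)^-1 + (base S (~~ b))^-1 ->
  unique_expansions S j -> j n = b ->
  coord b (tail n j) < 1 - (base S (~~ b))^-1.
Proof.
move=> overlap /(unique_expansions_tail n).
set t := tail n j => /unique_expansionsP tP jb.
rewrite ltNge; apply/negP => ge_t.
have r0 := base_gt0 (~~ b).
have rV : base S (~~ b) * (base S (~~ b))^-1 = 1 by rewrite divff // gt_eqF.
have t1 := coord_le1 b t.
have [|k kE] := @coord_surj b (1 - base S (~~ b) * (1 - coord b t)) overlap.
  by apply/andP; split; nra.
have /esym := @coord_tailN b (scons (~~ b) k) erefl; rewrite tail_scons kE.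
have -> : 1 - (1 - base S (~~ b) * (1 - coord b t)) =
          base S (~~ b) * (1 - coord b t) by ring.
move=> /(mulfI (lt0r_neq0 r0)) /addrI /oppr_inj /coord_eq /tP /(congr1 (@^~ 0%N)).
by rewrite /= /t /tail add0n jb; case: (b).
Qed.

(** A competitor [k] has tails of the same value as those of [j] up to the first disagreement. There
    its tail starts with the other symbol, which forces the coordinate to be at least the excluded
    bound. *)
Lemma coord_lt_unique_expansions j :
  (forall b n, j n = b -> coord b (tail n j) < 1 - (base S (~~ b))^-1) ->
  unique_expansions S j.
Proof.
move=> jP; apply/unique_expansionsP => k eq_kj.
have same n : coord true (tail n k) = coord true (tail n j) ->
    k n = j n /\ coord true (tail n.+1 k) = coord true (tail n.+1 j).
  move=> E; have Eb b : coord b (tail n k) = coord b (tail n j).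
    by apply/coord_eq; move: E => /coord_eq.
  have eq_n : k n = j n.
    apply/eqP; apply: contraT => /eqP ne_kj; exfalso.
    have kn : tail n k 0%N = ~~ j n.
      by move: ne_kj; rewrite /tail add0n; case: (k n) (j n) => -[].
    have := jP _ n erefl; rewrite -Eb; have := coord_tailN kn.
    have := coord_le1 (j n) (tail 1 (tail n k)).
    have := coord_ge0 (j n) (tail 1 (tail n k)).
    have r0 := base_gt0 (~~ j n).
    have : base S (~~ j n) * (base S (~~ j n))^-1 = 1 by rewrite divff // gt_eqF.
    nra.
  split=> //; apply/(@coord_eq true)/(@coord_eq (j n)).
  by rewrite (tailS n k) (tailS n j) !coord_tail // Eb.
have all_eq n : coord true (tail n k) = coord true (tail n j).
  elim: n => [|n /same[]//]; rewrite !tail0; exact/coord_eq.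
by apply/funext => n; have [] := same n (all_eq n).
Qed.

(** * Alternating sequences, and the infinite and finite cases *)

(** [alternating b 1] and [alternating b 0] are each other's tails; eliminating the second
    coordinate from the two tail equations leaves this one. *)
Lemma coord_alternating1 b :
  (base S b * base S (~~ b) - 1) * coord b (alternating b 1) = base S (~~ b) - 1.
Proof.
have := @coord_tail b (alternating b 1) erefl.
have := @coord_tailN b (alternating b 0); rewrite /alternating /= addbT => /(_ erefl).
rewrite -/(alternating b 0) -/(alternating b 1) tail_alternatingS tail_alternating0.
by move=> + E; rewrite E => H; lra.
Qed.

Lemma infinite_unique_expansions b :
  1 + (base S (~~ b))^-1 < base S b -> 1 + (base S b)^-1 < base S (~~ b) ->
  infinite_set (unique_expansions S).
Proof.
move=> hb hc fin; apply: infinite_nat.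
have sub n : unique_expansions S (alternating b n).
  apply: coord_lt_unique_expansions => a m am.
  have {am} : tail m (alternating b n) 0%N = a by [].
  have [k ->] := tail_alternating b n m.
  have p1 := base_gt1 S b; have r1 := base_gt1 S (~~ b).
  have pV : base S b * (base S b)^-1 = 1 by rewrite divff // gt_eqF ?base_gt0.
  have rV : base S (~~ b) * (base S (~~ b))^-1 = 1.
    by rewrite divff // gt_eqF ?base_gt0.
  (* These are the two hypotheses with denominators cleared. *)
  have ltD : base S b < base S b * base S (~~ b) - 1 by nra.
  have ltDN : base S (~~ b) < base S b * base S (~~ b) - 1 by nra.
  have u1 := coord_alternating1 b; have u0 := coord_tail (j := alternating b 1) erefl.
  rewrite tail_alternatingS in u0.
  case: k => [|k].
    (* This tail starts with [~~ b], and its coordinate for that symbol is (p - 1) / (p r - 1),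
       where p = [base S b] and r = [base S (~~ b)]. *)
    rewrite {1}/alternating /= addbT => <-; rewrite negbK coordN u0.
    by apply: ltr_1subV (base_gt1 S b) ltD _; rewrite mulrBr mulrCA u1; ring.
  rewrite {1}/alternating /= => <-.
  (* Prepending [b] divides the coordinate by [base S b], so [alternating b 1] is the worst case. *)
  apply: (@le_lt_trans _ _ (coord b (alternating b 1))).
    2: exact: ltr_1subV (base_gt1 S (~~ b)) ltDN u1.
  elim: k => [//|k]; apply: le_trans.
  rewrite -(tail_alternatingS b k.+1) coord_tail //.
  have := coord_ge0 b (alternating b k.+2); nra.
rewrite (_ : setT = alternating b @^-1` unique_expansions S).
  by apply: finite_preimage => // m n _ _; exact: alternating_inj.
by apply/seteqP; split=> // n _; exact: sub.
Qed.

Lemma finite_unique_expansions b :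
  base S b <= 1 + (base S (~~ b))^-1 -> base S (~~ b) <= 2 ->
  finite_set (unique_expansions S).
Proof.
move=> hb hc.
have p1 := base_gt1 S b; have r1 := base_gt1 S (~~ b).
have pV : base S b * (base S b)^-1 = 1 by rewrite divff // gt_eqF ?base_gt0.
have rV : base S (~~ b) * (base S (~~ b))^-1 = 1.
  by rewrite divff // gt_eqF ?base_gt0.
have pV0 : 0 < (base S b)^-1 by rewrite invr_gt0 base_gt0.
have rV0 : 0 < (base S (~~ b))^-1 by rewrite invr_gt0 base_gt0.
(* With p = [base S b] and r = [base S (~~ b)]: 1 - 1/p = (p - 1)/p <= p - 1 <= 1/r. *)
have overlap : 1 <= (base S b)^-1 + (base S (~~ b))^-1 by nra.
have overlapN : 1 <= (base S (~~ b))^-1 + (base S (~~ ~~ b))^-1.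
  by rewrite negbK addrC.
suff const j : unique_expansions S j -> forall n, j n.+1 = j n.
  apply: (@sub_finite_set _ _ [set (fun=> false); (fun=> true)]).
    move=> j /const jE; have {}jE n : j n = j 0%N by elim: n => // n <-.
    by have -> : j = (fun=> j 0%N) by [exact/funext]; case: (j 0%N); [right|left].
  exact: finite_set2.
move=> jU n; apply/eqP; apply: contraT => /eqP jn; exfalso.
have lt_b m : j m = b -> coord b (tail m j) < 1 - (base S (~~ b))^-1.
  exact: unique_expansions_coord_lt.
have gt_c m : j m = ~~ b -> (base S b)^-1 < coord b (tail m j).
  move=> /(unique_expansions_coord_lt overlapN jU).
  by rewrite negbK coordN; lra.
have step m : j m = b -> coord b (tail m.+1 j) = base S b * coord b (tail m j).
  by move=> jm; rewrite tailS coord_tail.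
have stepN m : j m = ~~ b ->
    1 - coord b (tail m.+1 j) = base S (~~ b) * (1 - coord b (tail m j)).
  by move=> jm; rewrite tailS coord_tailN.
have dichotomy m : j m = b \/ j m = ~~ b by case: (j m) (b) => -[]; tauto.
have bcb m : j m = b -> j m.+1 = ~~ b -> j m.+2 = b.
  move=> jm jm1; have [//|jm2] := dichotomy m.+2; exfalso.
  have lt_m := lt_b _ jm; have gt_m2 := gt_c _ jm2.
  (* If [b] were followed by [~~ b] twice, the third tail would have coordinate below (p - 1)(r - 1)
     <= 1 - 1/r <= 1/p, against [gt_c]. *)
  have st : (base S b - 1) * (base S (~~ b) - 1) <= 1 - (base S (~~ b))^-1 by nra.
  have := stepN _ jm1; rewrite (step _ jm).
  have : base S b * base S (~~ b) * coord b (tail m j) <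
         base S b * base S (~~ b) * (1 - (base S (~~ b))^-1).
    by rewrite ltr_pM2l // mulr_gt0 ?base_gt0.
  rewrite [X in _ < X]mulrBr -[X in _ < _ - X]mulrA rV; lra.
have cbc m : j m = ~~ b -> j m.+1 = b -> j m.+2 = ~~ b.
  move=> jm jm1; have [jm2|//] := dichotomy m.+2; exfalso.
  have lt_m2 := lt_b _ jm2; have gt_m := gt_c _ jm.
  (* If [~~ b] were followed by [b] twice, the third tail would have coordinate above 1 - (p - 1)(r
     - 1), against [lt_b]. The bound uses p - 1 <= 1/r and r <= 2. *)
  have st : (base S b - 1) * (base S (~~ b) - 1) <= (base S (~~ b))^-1 by nra.
  move: lt_m2; rewrite (step _ jm1).
  have -> : coord b (tail m.+1 j) = 1 - base S (~~ b) * (1 - coord b (tail m j)).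
    by have := stepN _ jm; lra.
  have : base S (~~ b) * (base S b * (base S b)^-1) <
         base S (~~ b) * (base S b * coord b (tail m j)).
    by rewrite !ltr_pM2l ?base_gt0.
  rewrite pV; lra.
have alternate i : j (i + n).+1 = ~~ j (i + n)%N.
  elim: i => [|i IH]; first by move: jn; rewrite add0n; case: (j n.+1) (j n) => -[].
  rewrite addSn; have [ji|ji] := dichotomy (i + n)%N; rewrite ji ?negbK in IH.
    by rewrite IH negbK; apply: bcb.
  by rewrite IH; apply: cbc.
have [m mn jm] : exists2 m, (n <= m)%N & j m = b.
  have [|jc] := dichotomy n; first by exists n.
  exists n.+1 => //; have := alternate 0%N; rewrite add0n => ->.
  by rewrite jc negbK.
have tailE : tail m j = alternating b 1.
  apply/funext => i; elim: i => [|i IH]; first by rewrite /tail add0n.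
  have := alternate (i + m - n)%N; rewrite subnK ?(leq_trans mn) ?leq_addl //.
  rewrite /tail addSn => ->; rewrite -[j (i + m)%N]/(tail m j i) IH.
  by rewrite /alternating; case: i {IH} => [|i] /=; rewrite ?subSS ?subn0 /=;
    case: (b) => //=; rewrite ?negbK.
(* With u the coordinate of [alternating b 1], this gives r - 1 = (p r - 1) u <= r u, whereas [lt_b]
   gives r u < r - 1. *)
have le_D : base S b * base S (~~ b) - 1 <= base S (~~ b) by nra.
have := ler_wpM2r (coord_ge0 b (alternating b 1)) le_D.
rewrite coord_alternating1; have := lt_b _ jm; rewrite tailE.
by rewrite -(ltr_pM2l (base_gt0 (~~ b))) mulrBr rV mulr1; lra.
Qed.

End Coordinate.

(** * Specialisation to the symbol with the smaller base *)

Theorem theorem1p7 (R : realType) (S : alphabet_base_system R)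
    (hreg : regular S)
    (hd : digit S false <= 0 <= digit S true)
    (hq0 : 1 < base S false <= 2)
    (hq1 : 1 < base S true <= 2) :
  (base S false <= base S true ->
     (infinite_set (unique_expansions S) <->
      1 + (base S true)^-1 < base S false)) /\
  (base S true <= base S false ->
     (infinite_set (unique_expansions S) <->
      1 + (base S false)^-1 < base S true)).
Proof.
(* If the two constant sequences had a common value, it would be [lambda_min] and a fixed point of
   both prepending maps, so the first regularity inequality would compare it strictly with
   itself. *)
have nondeg : pi_val S (fun=> false) < pi_val S (fun=> true).
  have [+ _ _] := hreg; rewrite /lambda_min.
  have /andP[le_f le_t] := pi_val_bounds (fun=> true) hd.
  rewrite (min_idPl le_f) => lt_l.
  rewrite lt_neqAle le_f andbT; apply/eqP => E; move: lt_l; rewrite E.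
  have Ef := pi_val_tail S (fun=> false); have Et := pi_val_tail S (fun=> true).
  rewrite /tail /= in Ef Et.
  by rewrite -{1}E -Ef -Et E ltxx.
have q0_gt0 := base_gt0 S false; have q1_gt0 := base_gt0 S true.
have main b : base S b <= base S (~~ b) ->
    (infinite_set (unique_expansions S) <-> 1 + (base S (~~ b))^-1 < base S b).
  move=> le_b; split=> [inf|lt_b].
    rewrite ltNge; apply/negP => ge_b; apply: inf.
    apply: (@finite_unique_expansions _ _ hd nondeg b) => //.
    by case: (b); [case/andP: hq0|case/andP: hq1].
  apply: (@infinite_unique_expansions _ _ hd nondeg b) => //.
  (* The condition for the smaller base p implies the one for r: p r > r + 1 >= p + 1, then divide
     by p. *)
  have p1 := base_gt1 S b; have p0 := base_gt0 S b; have r0 := base_gt0 S (~~ b).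
  have pV : base S b * (base S b)^-1 = 1 by rewrite divff // gt_eqF.
  have rV : base S (~~ b) * (base S (~~ b))^-1 = 1 by rewrite divff // gt_eqF.
  have pV0 : 0 < (base S b)^-1 by rewrite invr_gt0.
  have rV0 : 0 < (base S (~~ b))^-1 by rewrite invr_gt0.
  nra.
by split; [exact: (main false)|exact: (main true)].
Qed.
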